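(* Let $L\subset\mathbb{R}P^n$ be a projective line and let $D\subset\mathbb{R}P^n$ be an $L$-convex-concave set. Suppose that there are four fixed points of $L$ such that, for every two-dimensional plane $N$ containing $L$, the section $D\cap N$ is an octagon whose sides lie on lines intersecting $L$ in these four points; that is, each such octagon has four pairs of ''parallel'' sides, the lines containing the two sides of each pair meeting $L$ in the same one of the four fixed points, and these four points do not depend on $N$. Then there exists an $(n-2)$-dimensional projective subspace of $\mathbb{R}P^n$ intersecting all planar sections $D\cap N$, where $N$ ranges over the two-dimensional planes containing $L$.
   Context: For a projective subspace $T\subset\mathbb{R}P^n$, $\mathbb{R}P^n/T$ is the projective space of dimension $n-\dim T-1$ whose points are the $(\dim T+1)$-dimensional subspaces containing $T$; the projection from the center $T$ sends $x\notin T$ to the span of $x$ and $T$. A nonempty subset of a projective space is convex if it is disjoint from some hyperplane $H$ and is convex in the affine space obtained by removing $H$. A closed set $D\subset\mathbb{R}P^n$ is $L$-convex-concave if: 1) $D\cap L=\emptyset$; 2) for every $(\dim L+1)$-dimensional subspace $N\supset L$ the section $D\cap N$ is convex; 3) for every $(\dim L-1)$-dimensional subspace $T\subset L$ the complement in $\mathbb{R}P^n/T$ of the projection of $D$ from the center $T$ is an open convex set. Octagons $D\cap N$ are convex polygons in the affine plane $N\setminus L$. *)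

(* Defs.v *)
From HB Require Import structures.
From mathcomp Require Import all_boot all_order all_algebra.
From mathcomp Require Import all_classical all_reals all_analysis.

Set Implicit Arguments.
Unset Strict Implicit.
Unset Printing Implicit Defensive.

Import Order.TTheory GRing.Theory Num.Theory.
Import numFieldNormedType.Exports.

Local Open Scope classical_set_scope.
Local Open Scope ring_scope.

(* A d-dimensional projective subspace of RP^n is a (d+1)-dimensional linear
   subspace of R^(n+1); d = -1 is the empty projective subspace. *)
Notation psubspace R n := {vspace 'rV[R]_n.+1}.

(* The points of the projective space N/T, for T <= N: the projective subspaces
   of N of dimension dim T + 1 containing T. RP^n is the case T = 0, N = fullv,
   N itself is the case T = 0, and RP^n/T is the case N = fullv. *)
Definition ppoints (R : realType) (n : nat) (T N : psubspace R n) :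
    set (psubspace R n) :=
  [set U | [/\ (T <= U)%VS, (U <= N)%VS & \dim U = (\dim T).+1]].

Definition RP (R : realType) (n : nat) : set (psubspace R n) :=
  ppoints 0%VS fullv.

Definition section (R : realType) (n : nat) (D : set (psubspace R n))
    (N : psubspace R n) : set (psubspace R n) :=
  D `&` [set U | (U <= N)%VS].

(* Meant for D disjoint from the center T. *)
Definition projection (R : realType) (n : nat) (T : psubspace R n)
    (D : set (psubspace R n)) : set (psubspace R n) :=
  [set (T + U)%VS | U in D].

(* Openness in the quotient topology of RP^n/T, for the quotient map
   x |-> T + <[x]> defined on the open set R^(n+1) \ T. *)
Definition popen (R : realType) (n : nat) (T : psubspace R n)
    (A : set (psubspace R n)) : Prop :=
  A `<=` ppoints T fullv /\
  open [set x : 'rV[R]_n.+1 | x \notin T /\ A (T + <[x]>)%VS].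

Definition pclosed (R : realType) (n : nat) (D : set (psubspace R n)) : Prop :=
  D `<=` @RP R n /\ popen 0%VS (@RP R n `\` D).

(* Convexity in the projective space N/T. For a vector a of N outside the
   hyperplane H, the vectors of a + H are representatives of the points of the
   complement of H, and x |-> T + <[x]> is an affine map from a + H onto this
   complement. *)
Definition pconvex (R : realType) (n : nat) (T N : psubspace R n)
    (A : set (psubspace R n)) : Prop :=
  [/\ A `<=` ppoints T N,
      A !=set0 &
      exists H : psubspace R n,
        [/\ (T <= H <= N)%VS, (\dim H).+1 = \dim N,
            (forall U, A U -> ~~ (U <= H)%VS) &
            forall a, a \in N -> a \notin H ->
              convex_set [set x : 'rV[R]_n.+1 | x - a \in H /\ A (T + <[x]>)%VS]]].

Definition L_convex_concave (R : realType) (n : nat) (L : psubspace R n)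
    (D : set (psubspace R n)) : Prop :=
  [/\ pclosed D,
      section D L = set0,
      (forall N : psubspace R n, (L <= N)%VS -> \dim N = (\dim L).+1 ->
         pconvex 0%VS N (section D N)) &
      (forall T : psubspace R n, (T <= L)%VS -> (\dim T).+1 = \dim L ->
         let A := ppoints T fullv `\` projection T D in
         popen T A /\ pconvex T fullv A)].

(* The line through the vertices number i and i+1 (mod k). *)
Definition side_line (R : realType) (n k : nat) (x : 'I_k -> 'rV[R]_n.+1)
    (i : 'I_k) : psubspace R n :=
  (<[x i]> + <[x (ordS i)]>)%VS.

(* For a plane N and a line L of N, E is the convex polygon of the affine plane
   N \ L whose k >= 3 vertices are, in cyclic order, the points <[x i]>. The
   vectors x i lie in one translate of L, so affine combinations of points of
   N \ L are computed on them. Consecutive vertices span a side: all the other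
   vertices lie strictly on one side of the line through them. *)
Definition convex_polygon (R : realType) (n k : nat) (L N : psubspace R n)
    (x : 'I_k -> 'rV[R]_n.+1) (E : set (psubspace R n)) : Prop :=
  [/\ (forall i, x i \in N /\ x i \notin L),
      (forall i j, x i - x j \in L),
      (forall i j l : 'I_k, j \notin [:: i; ordS i] -> l \notin [:: i; ordS i] ->
         forall t : R, 0 <= t <= 1 ->
           (1 - t) *: x j + t *: x l \notin side_line x i) &
      E = [set U | exists a : 'I_k -> R,
             [/\ forall i, 0 <= a i, \sum_i a i = 1 &
                 U = <[\sum_i a i *: x i]>%VS]]].

(* The lines of the eight sides meet L in the points p j, two sides for each
   of the four points. *)
Definition octagon_with_directions (R : realType) (n : nat)
    (L N : psubspace R n) (p : 'I_4 -> psubspace R n)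
    (E : set (psubspace R n)) : Prop :=
  exists x : 'I_8 -> 'rV[R]_n.+1,
    [/\ convex_polygon L N x E,
        (forall i, exists j, (p j <= side_line x i)%VS) &
        (forall j, #|[set i : 'I_8 | (p j <= side_line x i)%VS]%SET| = 2%N)].

(* Main.v *)
Require Import Defs.
From HB Require Import structures.
From mathcomp Require Import all_boot all_order all_algebra.
From mathcomp Require Import all_classical all_reals all_analysis.
From mathcomp Require Import ring lra.

Set Implicit Arguments.
Unset Strict Implicit.
Unset Printing Implicit Defensive.

Import Order.TTheory GRing.Theory Num.Theory.
Import numFieldNormedType.Exports.

Local Open Scope classical_set_scope.
Local Open Scope ring_scope.

(* Write V = R^(n+1). For x outside L, the points of D in the plane spanned by L
   and x are represented by the convex octagon S x = {y in x + L | <[y]> in D}.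
   Let xi_j be linear forms on V whose restrictions to L have kernels p j, and
   let h_j x be the maximum of xi_j over S x (0 for x in L). Convexity of the
   complements of the projections says that every h_j is sublinear on V, and
   S x is cut out of x + L by the inequalities xi_j y <= h_j x and
   - xi_j y <= h_j (- x). So it suffices to find a linear map F : V -> L with
   xi_j (F x) <= h_j x for all j and x, and to take for M the set of the x whose
   projection to L is F x. By Hahn-Banach such an F exists as soon as
   \sum_j h_j (u_j) >= 0 for all u_j in V such that \sum_j xi_j(l) u_j = 0 on L.
   Normalise xi_j = al + t_j be with t_1 < .. < t_4. Then the u_j are, up to
   alternating signs and positive factors, of the form y_j = A + t_j B, and the
   inequality is a positive combination of sublinearity inequalities of h_1 and
   h_2 between the y_j, and of relations between the h_j at a single y_j that
   hold for the support functions of any convex set. *)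

(** * Sublinear functions *)

Definition sublinear (R : realType) (V : lmodType R) (h : V -> R) :=
  (forall a x, 0 < a -> h (a *: x) = a * h x) /\
  (forall x y, h (x + y) <= h x + h y).

Lemma sublinearP (R : realType) (V : lmodType R) (h : V -> R) (a b : R) x y :
  sublinear h -> 0 < a -> 0 < b -> h (a *: x + b *: y) <= a * h x + b * h y.
Proof. by move=> [hZ hD] a0 b0; rewrite -!hZ. Qed.

Lemma sublinear_comb (R : realType) (V : lmodType R) (h : V -> R) (c a b : R)
    (x y z : V) : sublinear h -> 0 < c -> 0 < a -> 0 < b ->
  c *: z = a *: x + b *: y -> c * h z <= a * h x + b * h y.
Proof. by move=> hh c0 a0 b0 e; rewrite -(proj1 hh) // e sublinearP. Qed.

(* In four_sublinear_ge0, a, b, c are the gaps between the t_i, and hij is the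
   value at y_j or - y_j of the function attached to + xi_i or - xi_i. The first
   three inequalities bound h13 by h24, the last three bound h24 by h13, and
   adding the two bounds cancels both. *)
Lemma cycle_ge0 (R : realFieldType)
    (a b c h11 h12 h13 h14 h44 h24 h23 h21 h22 h33 : R) :
  0 < a -> 0 < b -> 0 < c ->
  (b + c) * h13 <= c * h12 + b * h14 ->
  (a + b) * h12 <= b * h11 + a * h13 ->
  (b + c) * h14 <= a * h44 + (a + b + c) * h24 ->
  (a + b) * h24 <= (a + b + c) * h23 + c * h21 ->
  (a + b) * h23 <= b * h13 + a * h33 ->
  (b + c) * h21 <= (a + b + c) * h22 + a * h24 ->
  0 <= h11 / (a * (a + b) * (a + b + c)) + h22 / (a * b * (b + c)) +
       h33 / ((a + b) * b * c) + h44 / ((a + b + c) * (b + c) * c).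
Proof.
move=> a0 b0 c0 i1 i2 i3 i4 i5 i6.
have ab0 : 0 < a + b by lra.
have bc0 : 0 < b + c by lra.
have abc0 : 0 < a + b + c by lra.
(* Up to a common positive factor, the first three inequalities get the weights 1, [c / (a + b)] and
   [b / (b + c)], which eliminate [h12] and [h14]. *)
have step1 : h13 / (a + b) <= h24 / (b + c) +
    c / ((a + b + c) * (a + b)) * h11 + a / ((a + b + c) * (b + c)) * h44.
  rewrite -subr_ge0.
  have -> : h24 / (b + c) +
    c / ((a + b + c) * (a + b)) * h11 + a / ((a + b + c) * (b + c)) * h44 -
     h13 / (a + b) = ((c * h12 + b * h14 - (b + c) * h13) +
      c / (a + b) * (b * h11 + a * h13 - (a + b) * h12) +
      b / (b + c) * (a * h44 + (a + b + c) * h24 - (b + c) * h14)) /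
      ((a + b + c) * b).
    by field; rewrite !gt_eqF.
  apply: divr_ge0; last by rewrite mulr_ge0 ?ltW.
  by apply: addr_ge0; [apply: addr_ge0|];
    rewrite ?(mulr_ge0 (divr_ge0 _ _)) ?subr_ge0 // ltW.
(* Likewise the weights 1, [(a + b + c) / (a + b)] and [c / (b + c)] on the last three eliminate
   [h23] and [h21]. *)
have step2 : h24 / (b + c) <= h13 / (a + b) +
    a / ((a + b) * b) * h33 + c / ((b + c) * b) * h22.
  rewrite -subr_ge0.
  have -> : h13 / (a + b) + a / ((a + b) * b) * h33 + c / ((b + c) * b) * h22 -
     h24 / (b + c) = (((a + b + c) * h23 + c * h21 - (a + b) * h24) +
      (a + b + c) / (a + b) * (b * h13 + a * h33 - (a + b) * h23) +
      c / (b + c) * ((a + b + c) * h22 + a * h24 - (b + c) * h21)) /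
      ((a + b + c) * b).
    by field; rewrite !gt_eqF.
  apply: divr_ge0; last by rewrite mulr_ge0 ?ltW.
  by apply: addr_ge0; [apply: addr_ge0|];
    rewrite ?(mulr_ge0 (divr_ge0 _ _)) ?subr_ge0 // ltW.
have : 0 <= (c / ((a + b + c) * (a + b)) * h11 +
  a / ((a + b + c) * (b + c)) * h44 + a / ((a + b) * b) * h33 +
  c / ((b + c) * b) * h22) / (a * c).
  by apply: divr_ge0; [lra|rewrite mulr_ge0 ?ltW].
congr (_ <= _).
by field; rewrite !gt_eqF.
Qed.

(** The two vector relations force [u_i] times the product of the [t_i - t_j], [j != i], to be an
    affine function of [t_i]. The two pointwise hypotheses are those satisfied by support functions
    of forms [al + t_i be]. *)
Lemma four_sublinear_ge0 (R : realType) (m : nat)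
    (h1 h2 h3 h4 : 'rV[R]_m -> R) (t1 t2 t3 t4 : R) (u1 u2 u3 u4 : 'rV[R]_m) :
  sublinear h1 -> sublinear h2 -> sublinear h3 -> sublinear h4 ->
  t1 < t2 -> t2 < t3 -> t3 < t4 ->
  (forall w, (t4 - t2) * h1 w <= (t2 - t1) * h4 (- w) + (t4 - t1) * h2 w) ->
  (forall w, (t3 - t1) * h2 w <= (t3 - t2) * h1 w + (t2 - t1) * h3 w) ->
  u1 + u2 + u3 + u4 = 0 ->
  t1 *: u1 + t2 *: u2 + t3 *: u3 + t4 *: u4 = 0 ->
  0 <= h1 u1 + h2 u2 + h3 u3 + h4 u4.
Proof.
move=> s1 s2 s3 s4 t12 t23 t34 i1 i2 su stu.
set a := t2 - t1; set b := t3 - t2; set c := t4 - t3.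
have a0 : 0 < a by rewrite subr_gt0.
have b0 : 0 < b by rewrite subr_gt0.
have c0 : 0 < c by rewrite subr_gt0.
have ab0 : 0 < a + b by lra.
have bc0 : 0 < b + c by lra.
have abc0 : 0 < a + b + c by lra.
have eab : t3 - t1 = a + b by rewrite /a /b; ring.
have ebc : t4 - t2 = b + c by rewrite /c /b; ring.
have eabc : t4 - t1 = a + b + c by rewrite /a /c /b; ring.
(* Each [y_i] is minus the product of the [t_i - t_j] times [u_i], whence the alternating signs. *)
pose y1 := (a * (a + b) * (a + b + c)) *: u1.
pose y2 := - ((a * b * (b + c)) *: u2).
pose y3 := ((a + b) * b * c) *: u3.
pose y4 := - (((a + b + c) * (b + c) * c) *: u4).
have co k : u1 ord0 k + u2 ord0 k + u3 ord0 k + u4 ord0 k = 0.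
  by have /rowP/(_ k) := su; rewrite !mxE.
have cot k : a * u2 ord0 k + (a + b) * u3 ord0 k + (a + b + c) * u4 ord0 k = 0.
  have /rowP/(_ k) := stu; rewrite !mxE => e.
  have := co k; rewrite /a /b /c => e'; nra.
have e4 k : u4 ord0 k = - (a * u2 ord0 k + (a + b) * u3 ord0 k) / (a + b + c).
  apply: (mulIf (lt0r_neq0 abc0)); rewrite mulfVK ?gt_eqF //.
  by have := cot k; lra.
have e1 k : u1 ord0 k = - u2 ord0 k - u3 ord0 k - u4 ord0 k.
  by have := co k; lra.
have vec (p q r : R) (x y z : 'rV[R]_m) :
   (forall k, p * x ord0 k = q * y ord0 k + r * z ord0 k) ->
   p *: x = q *: y + r *: z.
  by move=> e; apply/rowP => k; rewrite !mxE.
(* The [y_i] are values of one affine function at the [t_i]: [r1] and [r2] interpolate it, [r4] and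
   [r6] extrapolate it. *)
have r1 : (b + c) *: y3 = c *: y2 + b *: y4.
  by apply: vec => k; rewrite !mxE e4; field; rewrite gt_eqF.
have r2 : (a + b) *: y2 = b *: y1 + a *: y3.
  by apply: vec => k; rewrite !mxE e1 e4; field; rewrite gt_eqF.
have r4 : (a + b) *: y4 = (a + b + c) *: y3 + c *: (- y1).
  by apply: vec => k; rewrite !mxE e1 e4; field; rewrite gt_eqF.
have r6 : (b + c) *: (- y1) = (a + b + c) *: (- y2) + a *: y4.
  by apply: vec => k; rewrite !mxE e1 e4; field; rewrite gt_eqF.
have j1 := sublinear_comb s1 bc0 c0 b0 r1.
have j2 := sublinear_comb s1 ab0 b0 a0 r2.
have j3 := i1 y4; rewrite ebc eabc -/a in j3.
have j4 := sublinear_comb s2 ab0 abc0 c0 r4.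
have j5 := i2 y3; rewrite eab -/a -/b in j5.
have j6 := sublinear_comb s2 bc0 abc0 a0 r6.
have := cycle_ge0 a0 b0 c0 j1 j2 j3 j4 j5 j6.
have hK h (k : R) u : sublinear h -> 0 < k -> h (k *: u) / k = h u :> R.
  by move=> [hZ _] k0; rewrite hZ // mulrC mulKf ?gt_eqF.
by rewrite /y1 /y2 /y3 /y4 !opprK !hK ?mulr_gt0.
Qed.

(** * Linear forms below sublinear functions *)

Lemma lfun_of_linear (K : fieldType) (V W : vectType K) (g : V -> W) :
  linear g -> exists f : 'Hom(V, W), f =1 g.
Proof.
move=> lg; pose l : {linear V -> W} :=
  HB.pack g (GRing.isLinear.Build _ _ _ _ g lg).
by exists (linfun l) => x; rewrite lfunE.
Qed.

Lemma form_of_scalar (K : fieldType) (V : vectType K) (g : V -> K) :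
  scalar g -> exists f : {scalar V}, f =1 g.
Proof.
move=> lg; pose l : {scalar V} :=
  HB.pack g (GRing.isLinear.Build _ _ _ _ g lg).
by exists l.
Qed.

(** The form is the coordinate along [v] in the free family made of [v] and a basis of [U]. *)
Lemma separating_form (K : fieldType) (V : vectType K) (U : {vspace V})
    (v : V) : v \notin U ->
  exists f : {scalar V}, (forall u, u \in U -> f u = 0) /\ f v = 1.
Proof.
move=> vU; pose X := [tuple of v :: vbasis U].
have fX : free X.
  by rewrite free_cons (span_basis (vbasisP U)) vU (basis_free (vbasisP U)).
exists (coord X ord0 : {scalar V}); split=> [u uU|] /=.
  rewrite (coord_vbasis uU) linear_sum big1 // => i _; rewrite linearZ /=.
  have := coord_free (lift ord0 i) ord0 fX; rewrite [X`_ _]/= => ->.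
  by rewrite mulr0.
by have := coord_free ord0 ord0 fX; rewrite [X`_ _]/= eqxx.
Qed.

(** The value at [v] has to lie above every [F u - P (u - v)] and below every [P (u + v) - F u].
    Sublinearity makes this possible, and the supremum of the lower bounds is taken. *)
Lemma hahn_banach_step (R : realType) (V : vectType R) (P : V -> R)
    (U : {vspace V}) (F : {scalar V}) (v : V) :
  sublinear P -> v \notin U -> (forall u, u \in U -> F u <= P u) ->
  exists G : {scalar V}, (forall u, u \in U -> G u = F u) /\
    forall u, u \in (U + <[v]>)%VS -> G u <= P u.
Proof.
move=> [PZ PD] vU FP; have [f [fU fv]] := separating_form vU.
pose E := [set F u - P (u - v) | u in [set u | u \in U]].
have ub w : w \in U -> ubound E (P (w + v) - F w).
  move=> wU _ [u /= uU <-]; rewrite lerBlDr addrAC lerBrDl.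
  rewrite (_ : F w + F u = F (w + u)); last by rewrite linearD.
  apply: le_trans (FP _ (rpredD wU uU)) _.
  by rewrite (_ : w + u = (w + v) + (u - v)) ?PD // addrACA subrr addr0.
have E0 : E !=set0 by exists (F 0 - P (0 - v)); exists 0 => //=; rewrite mem0v.
have supE : has_sup E.
  by split => //; exists (P (0 + v) - F 0); apply: ub; rewrite mem0v.
pose c := sup E.
have cl u : u \in U -> F u - P (u - v) <= c.
  by move=> uU; apply: ub_le_sup; [case: supE|exists u].
have cu u : u \in U -> c <= P (u + v) - F u.
  by move=> uU; apply: ge_sup => //; apply: ub.
have [G GE] : exists G : {scalar V}, forall x, G x = F x + (c - F v) * f x.
  by apply: form_of_scalar => a x y; rewrite !linearP; ring.
exists G; split=> [u uU|_ /memv_addP[u uU [_ /vlineP[s ->] ->]]].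
  by rewrite GE fU // mulr0 addr0.
have -> : G (u + s *: v) = F u + s * c.
  by rewrite GE (linearD F) (linearD f) !linearZ /= fU // fv; ring.
(* Dividing by the absolute value of [s] reduces the bound to [cu] if [s] is positive and to [cl] if
   it is negative. *)
have [s0|s0|->] := ltgtP s 0; last first.
- by rewrite scale0r mul0r !addr0 FP.
- have := cu _ (rpredZ s^-1 uU); rewrite linearZ /= => h.
  have : s * c <= s * (P (s^-1 *: u + v) - s^-1 * F u) by rewrite ler_pM2l.
  rewrite mulrBr -PZ // scalerDr scalerA mulVKf ?mulfV ?gt_eqF // scale1r.
  by lra.
- pose r := - s; have r0 : 0 < r by rewrite oppr_gt0.
  have := cl _ (rpredZ r^-1 uU); rewrite linearZ /= => h.
  have : r * (r^-1 * F u - P (r^-1 *: u - v)) <= r * c by rewrite ler_pM2l.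
  rewrite mulrBr -PZ // scalerBr scalerA mulVKf ?mulfV ?gt_eqF // scale1r.
  by rewrite /r scaleNr opprK; lra.
Qed.

(** Induction on the codimension of [U], one new vector at a time. *)
Lemma hahn_banach (R : realType) (V : vectType R) (P : V -> R)
    (U : {vspace V}) (F : {scalar V}) :
  sublinear P -> (forall u, u \in U -> F u <= P u) ->
  exists G : {scalar V}, (forall u, u \in U -> G u = F u) /\
    forall u, G u <= P u.
Proof.
move=> sP; have [k] := ubnP (\dim {:V} - \dim U).
elim: k => // k IH in U F *; rewrite ltnS => dU FP.
have [UV|/subvPn[v _ vU]] := boolP (fullv <= U)%VS.
  by exists F; split=> // u; apply: FP; rewrite (subvP UV) ?memvf.
have [G [GU GP]] := hahn_banach_step sP vU FP.
have UUv : (U <= U + <[v]>)%VS by exact: addvSl.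
have dUv : (\dim U < \dim (U + <[v]>))%N.
  rewrite ltnNge; apply: contra vU => dUv.
  have /eqP -> : U == (U + <[v]>)%VS by rewrite eqEdim UUv.
  exact: (subvP (addvSr _ _) _ (memv_line v)).
have [|G' [G'U G'P]] := IH _ G _ GP.
  apply: leq_trans dU; apply: ltn_sub2l => //.
  exact: leq_trans dUv (dimvS (subvf _)).
by exists G'; split=> // u uU; rewrite G'U ?GU // (subvP UUv).
Qed.

Lemma sublinear_sum (R : realType) (V : vectType R) (I : finType)
    (h : I -> V -> R) :
  (forall i, sublinear (h i)) ->
  sublinear (fun x : {ffun I -> V} => \sum_i h i (x i)).
Proof.
move=> sh; split=> [a x a0|x y].
  by rewrite mulr_sumr; apply: eq_bigr => i _; rewrite ffunE (proj1 (sh i)).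
by rewrite -big_split /=; apply: ler_sum => i _; rewrite ffunE (proj2 (sh i)).
Qed.

(** On families [u], the hypothesis says that the zero form is below the sum of the [h i (u i)] on
    the kernel of [A], which sends [u] to the pair of its two sums. A dominated extension kills this
    kernel, hence is [f] of the first sum plus [g] of the second. *)
Lemma simultaneous_functionals (R : realType) (V : vectType R) (I : finType)
    (t : I -> R) (h : I -> V -> R) :
  (forall i, sublinear (h i)) ->
  (forall u : I -> V, \sum_i u i = 0 -> \sum_i t i *: u i = 0 ->
     0 <= \sum_i h i (u i)) ->
  exists f g : {scalar V}, forall i x, f x + t i * g x <= h i x.
Proof.
move=> sh h0.
pose W : vectType R := {ffun I -> V}.
have [A AE] : exists A : 'Hom(W, (V * V)%type),
    forall x, A x = (\sum_i x i, \sum_i t i *: x i).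
  apply: lfun_of_linear => a x y; congr pair => /=;
    rewrite scaler_sumr -big_split /=; apply: eq_bigr => i _; rewrite !ffunE //.
  by rewrite scalerDr !scalerA mulrC.
pose P (x : W) := \sum_i h i (x i).
have sP : sublinear P := sublinear_sum sh.
have [Z ZE] : exists Z : {scalar W}, Z =1 fun=> 0.
  by apply: form_of_scalar => a x y; rewrite mulr0 addr0.
have [|F [F0 FP]] := @hahn_banach _ _ P (lker A) Z sP.
  by move=> u; rewrite memv_ker AE ZE => /eqP[u0 tu0]; apply: h0.
(* [A^-1] returns some preimage of [A x], and [F] does not depend on which one. *)
have FA x : F x = F ((A^-1)%VF (A x)).
  apply/eqP; rewrite -subr_eq0; apply/eqP.
  have /F0 : x - (A^-1)%VF (A x) \in lker A.
    by rewrite memv_ker linearB /= limg_lfunVK ?subrr // memv_img ?memvf.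
  by rewrite linearB ZE.
have linG a x y : F ((A^-1)%VF (a *: x + y)) =
    a * F ((A^-1)%VF x) + F ((A^-1)%VF y) by rewrite !linearP.
have [f fE] : exists f : {scalar V}, forall x, f x = F ((A^-1)%VF (x, 0)).
  apply: form_of_scalar => a x y; rewrite -linG; congr (F (_ _)).
  by congr pair; rewrite /= scaler0 addr0.
have [g gE] : exists g : {scalar V}, forall x, g x = F ((A^-1)%VF (0, x)).
  apply: form_of_scalar => a x y; rewrite -linG; congr (F (_ _)).
  by congr pair; rewrite /= scaler0 addr0.
exists f, g => i x.
(* The family with the single nonzero entry [x] at [i] isolates [h i x]. *)
pose u : W := [ffun j => if j == i then x else 0].
have uE (c : I -> R) : \sum_j c j *: u j = c i *: x.
  rewrite (bigD1 i) //= ffunE eqxx big1 ?addr0 // => j /negbTE ji.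
  by rewrite ffunE ji scaler0.
have -> : f x + t i * g x = F u.
  rewrite FA AE uE; have := uE (fun=> 1); under eq_bigr do rewrite scale1r.
  move=> ->; rewrite scale1r fE gE addrC -linG; congr (F (_ _)).
  by congr pair; rewrite /= ?scaler0 ?addr0 ?add0r.
have h00 j : h j 0 = 0.
  by have := proj1 (sh j) 2 0 ltac:(lra); rewrite scaler0; lra.
apply: le_trans (FP u) _; rewrite /P (bigD1 i) //= ffunE eqxx big1 ?addr0 //.
by move=> j /negbTE ji; rewrite ffunE ji.
Qed.

(** * Convex polygons *)

(** Twice the signed area of the triangle [a b c]; its sign tells the side of the line [a b] on
    which [c] lies. *)
Definition orient (R : pzRingType) (a b c : R * R) : R :=
  (b.1 - a.1) * (c.2 - a.2) - (b.2 - a.2) * (c.1 - a.1).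

Lemma orient_rot (R : comPzRingType) (a b c : R * R) :
  orient a b c = orient b c a.
Proof. rewrite /orient; ring. Qed.

Lemma orient_swap (R : comPzRingType) (a b c : R * R) :
  orient a b c = - orient b a c.
Proof. rewrite /orient; ring. Qed.

Lemma sign_change (R : realDomainType) (d : nat -> R) (k : nat) :
  0 <= d 0%N -> d k.+1 <= 0 ->
  exists n, [/\ (n <= k)%N, 0 <= d n & d n.+1 <= 0].
Proof.
elim: k => [|k IH] d0 dk; first by exists 0%N.
have [dk1|/ltW dk1] := lerP 0 (d k.+1); first by exists k.+1.
by have [n [nk ? ?]] := IH d0 dk1; exists n; split=> //; apply: leqW.
Qed.

(** The barycentric coordinates of [z] are ratios of oriented areas; the factor [s] allows for both
    orientations of the triangle. *)
Lemma in_triangle (R : realFieldType) (I : finType) (x : I -> R * R) (z : R * R)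
    (i j l : I) (s : R) :
  0 < s * orient (x i) (x j) (x l) -> 0 <= s * orient (x i) (x j) z ->
  0 <= s * orient (x j) (x l) z -> 0 <= s * orient (x l) (x i) z ->
  exists a : I -> R, [/\ forall i, 0 <= a i, \sum_i a i = 1,
    \sum_i a i * (x i).1 = z.1 & \sum_i a i * (x i).2 = z.2].
Proof.
move=> D0 l0 i0 j0; set D := orient _ _ _ in D0.
have : s * D != 0 by rewrite gt_eqF.
rewrite mulf_eq0 negb_or => /andP[sn0 Dn0].
pose b (p q : I) := orient (x p) (x q) z / D.
have b_ge0 p q : 0 <= s * orient (x p) (x q) z -> 0 <= b p q.
  move=> h; have -> : b p q = (s * orient (x p) (x q) z) / (s * D).
    by rewrite /b; field; rewrite sn0 Dn0.
  by rewrite divr_ge0 // ltW.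
pose a m := b j l * (m == i)%:R + b l i * (m == j)%:R + b i j * (m == l)%:R.
have sum1 (f : I -> R) p : \sum_m (m == p)%:R * f m = f p.
  rewrite (bigD1 p) //= eqxx mul1r big1 ?addr0 // => m /negbTE ->.
  by rewrite mul0r.
have sumE (f : I -> R) :
    \sum_m a m * f m = b j l * f i + b l i * f j + b i j * f l.
  rewrite -!(sum1 f) !mulr_sumr -!big_split; apply: eq_bigr => m _ /=.
  by rewrite /a; ring.
exists a; split.
- by move=> m; rewrite !addr_ge0 // mulr_ge0 ?ler0n // b_ge0.
- transitivity (\sum_m a m * 1); first by apply: eq_bigr => m _; rewrite mulr1.
  by rewrite sumE /b; move: Dn0; rewrite /D /orient => Dn0; field.
- by rewrite sumE /b; move: Dn0; rewrite /D /orient => Dn0; field.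
- by rewrite sumE /b; move: Dn0; rewrite /D /orient => Dn0; field.
Qed.

(* The rays from the vertex 0 to the other vertices cut the polygon into
   triangles; z lies in the triangle where its side of the ray changes. *)
Lemma polygon_of_halfplanes (R : realFieldType) (k : nat)
    (x : 'I_k.+3 -> R * R) (z : R * R) :
  (forall i j l : 'I_k.+3, j \notin [:: i; ordS i] -> l \notin [:: i; ordS i] ->
     0 < orient (x i) (x (ordS i)) (x j) * orient (x i) (x (ordS i)) (x l)) ->
  (forall i j, 0 <= orient (x i) (x (ordS i)) (x j) *
                    orient (x i) (x (ordS i)) z) ->
  exists a : 'I_k.+3 -> R, [/\ forall i, 0 <= a i, \sum_i a i = 1,
    \sum_i a i * (x i).1 = z.1 & \sum_i a i * (x i).2 = z.2].
Proof.
move=> conv zin.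
pose y n := x (inord n).
have inS n : (n < k.+2)%N -> ordS (inord n : 'I_k.+3) = inord n.+1.
  move=> nk; apply: val_inj => /=; rewrite !inordK ?modn_small //.
  by rewrite ltnW.
have inL : ordS (inord k.+2 : 'I_k.+3) = inord 0.
  by apply: val_inj => /=; rewrite !inordK ?modnn.
have inE3 n m : (n < k.+3)%N -> (m < k.+3)%N ->
    ((inord n : 'I_k.+3) == inord m) = (n == m).
  by move=> nk mk; rewrite -val_eqE /= !inordK.
have notin n m : (n < k.+2)%N -> (m < k.+3)%N -> m != n -> m != n.+1 ->
    (inord m : 'I_k.+3) \notin [:: inord n; ordS (inord n)].
  move=> nk mk mn mn1; rewrite inS // !inE !inE3 ?negb_or ?mn ?mn1 //.
  exact: ltnW.
pose s := orient (y 0) (y 1) (y 2).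
(* Consecutive edges share the triangle [y n], [y n.+1], [y n.+2], so the sign of [s] propagates
   from each edge to the next. *)
have side n m : (n < k.+2)%N -> (m < k.+3)%N -> m != n -> m != n.+1 ->
    0 < s * orient (y n) (y n.+1) (y m).
  elim: n m => [|n IH] m nk mk mn mn1.
    have := conv _ _ _ (notin 0 2 isT isT isT isT) (notin 0 m isT mk mn mn1).
    by rewrite inS.
  have nk2 : (n < k.+2)%N by apply: ltnW.
  have h1 : 0 < s * orient (y n) (y n.+1) (y n.+2).
    by apply: IH; rewrite ?gtn_eqF.
  have : 0 < orient (y n.+1) (y n.+2) (y n) * orient (y n.+1) (y n.+2) (y m).
    have := conv _ _ _ (notin n.+1 n nk (ltnW nk2) _ _)
      (notin n.+1 m nk mk mn mn1).
    by rewrite inS //; apply; rewrite ltn_eqF.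
  rewrite -(orient_rot (y n)) => h2; have := mulr_gt0 h1 h2.
  rewrite mulrA -(mulrA s) -expr2 mulrAC pmulr_lgt0 //.
  rewrite exprn_even_gt0 //=; apply/eqP => e; move: h1.
  by rewrite e mulr0 ltxx.
have sidez n : (n < k.+2)%N -> 0 <= s * orient (y n) (y n.+1) z.
  move=> nk.
  have [m [mk mn mn1]] : exists m, [/\ (m < k.+3)%N, m != n & m != n.+1].
    case: n nk => [|n] nk; [by exists 2%N | exists 0%N; split=> //].
  have := zin (inord n) (inord m); rewrite inS // => h.
  have h1 := side n m nk mk mn mn1.
  by rewrite -(pmulr_rge0 _ h1) mulrACA -expr2 mulr_ge0 ?sqr_ge0.
have sideL : 0 <= s * orient (y k.+2) (y 0) z.
  have := zin (inord k.+2) (inord 1); rewrite inL => h.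
  have h1 : 0 < s * orient (y k.+2) (y 0) (y 1).
    by rewrite orient_rot side.
  by rewrite -(pmulr_rge0 _ h1) mulrACA -expr2 mulr_ge0 ?sqr_ge0.
(* The first ray is the edge from [y 0] to [y 1], the last one is the closing edge traversed
   backwards, whence the opposite signs. *)
have [||n [nk d0 d1]] :=
  @sign_change _ (fun n => s * orient (y 0) (y n.+1) z) k.
- exact: sidez 0 isT.
- by rewrite orient_swap mulrN oppr_le0.
apply: (@in_triangle _ _ x z (inord 0) (inord n.+1) (inord n.+2) s) => //.
- by rewrite orient_rot side.
- by apply: sidez.
- by rewrite orient_swap mulrN oppr_ge0.
Qed.

(** * Affine sections of D *)

(** The forms are defined on the whole space and restrict on [L] to the coordinates in the basis
    [e1], [e2]; they thus serve as affine coordinates on every translate of [L]. *)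
Definition frame (R : realType) (n : nat) (L : psubspace R n)
    (al be : {scalar 'rV[R]_n.+1}) (e1 e2 : 'rV[R]_n.+1) : Prop :=
  [/\ e1 \in L /\ e2 \in L, al e1 = 1 /\ be e1 = 0, al e2 = 0 /\ be e2 = 1 &
      forall l, l \in L -> l = al l *: e1 + be l *: e2].

Lemma frame_inj (R : realType) (n : nat) (L : psubspace R n)
    (al be : {scalar 'rV[R]_n.+1}) e1 e2 y z :
  frame L al be e1 e2 -> y - z \in L -> al y = al z -> be y = be z -> y = z.
Proof.
move=> [_ _ _ fr] yz ay by_; apply/eqP; rewrite -subr_eq0 (fr _ yz) !linearB /=.
by rewrite ay by_ !subrr !scale0r addr0.
Qed.

(** The set S x: for [x] outside [L], each point off [L] of the plane spanned by [L] and [x] has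
    exactly one representative in [x + L]. *)
Definition affine_section (R : realType) (n : nat) (L : psubspace R n)
    (D : set (psubspace R n)) (x : 'rV[R]_n.+1) : set 'rV[R]_n.+1 :=
  [set y | y - x \in L /\ D <[y]>%VS].

Definition polygonal (R : realType) (n : nat) (L : psubspace R n)
    (D : set (psubspace R n)) (x : 'rV[R]_n.+1) :=
  exists v : 'I_8 -> 'rV[R]_n.+1, forall y, affine_section L D x y <->
    exists a : 'I_8 -> R,
      [/\ forall i, 0 <= a i, \sum_i a i = 1 & y = \sum_i a i *: v i].

Lemma vline_eq (K : fieldType) (V : vectType K) (u v : V) :
  u != 0 -> <[u]>%VS = <[v]>%VS -> exists2 c, c != 0 & u = c *: v.
Proof.
move=> u0 e; have : u \in <[v]>%VS by rewrite -e memv_line.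
case/vlineP => c uE; exists c => //; apply: contra u0 => /eqP c0.
by rewrite uE c0 scale0r.
Qed.

Lemma vlineZ (K : fieldType) (V : vectType K) (c : K) (v : V) :
  c != 0 -> <[c *: v]>%VS = <[v]>%VS.
Proof.
move=> c0; apply/eqP; rewrite eqEsubv -!memvE memvZ ?memv_line //=.
by rewrite -{1}(scale1r v) -(mulVf c0) -scalerA memvZ ?memv_line.
Qed.

Lemma zero_on_segment (R : realFieldType) (p q : R) :
  p * q <= 0 -> exists2 s, 0 <= s <= 1 & (1 - s) * p + s * q = 0.
Proof.
have main (p' q' : R) : 0 < p' -> q' <= 0 ->
    exists2 s, 0 <= s <= 1 & (1 - s) * p' + s * q' = 0.
  move=> p0 q0; have d0 : 0 < p' - q' by lra.
  exists (p' / (p' - q')); last by field; rewrite gt_eqF.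
  by apply/andP; split; [apply: divr_ge0 | rewrite ler_pdivrMr //]; lra.
have [p0|p0|->] := ltgtP p 0.
- rewrite nmulr_rle0 // => q0; have [||s s01 e] := main (- p) (- q); try lra.
  by exists s => //; lra.
- by rewrite pmulr_rle0 //; apply: main.
- by move=> _; exists 0; rewrite ?lexx ?ler01 //; ring.
Qed.

Lemma between_ge0 (R : realDomainType) (p a b y : R) :
  a <= y -> y <= b -> 0 <= p * a -> 0 <= p * b -> 0 <= p * y.
Proof.
move=> ay yb pa pb; have [p0|p0] := lerP 0 p.
  by apply: le_trans pa _; rewrite ler_wpM2l.
by apply: le_trans pb _; rewrite ler_nM2l.
Qed.

(** A side line through [p j] is a level line of [al + t j * be] in [x + L]. So a point belongs to
    the octagon as soon as each of the four forms takes there a value between two values attained on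
    the octagon. *)
Lemma octagon_affine (R : realType) (n : nat) (L : psubspace R n)
    (D : set (psubspace R n)) (p : 'I_4 -> psubspace R n)
    (al be : {scalar 'rV[R]_n.+1}) e1 e2 (t : 'I_4 -> R) (x : 'rV[R]_n.+1) :
  frame L al be e1 e2 -> (forall j, p j = <[e2 - t j *: e1]>%VS) ->
  x \notin L ->
  octagon_with_directions L (L + <[x]>)%VS p (section D (L + <[x]>)%VS) ->
  polygonal L D x /\
  forall y, y - x \in L ->
    (forall j, exists z1 z2,
       [/\ affine_section L D x z1, affine_section L D x z2,
       al y + t j * be y <= al z1 + t j * be z1 &
       al z2 + t j * be z2 <= al y + t j * be y]) ->
    affine_section L D x y.
Proof.
move=> fr pE xL [w [[wNL wL wconv DE] wside _]].
have [[e1L e2L] [a1 b1] [a2 b2] frE] := fr.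
have [phi [phiL phix]] := separating_form xL.
have memN z : z \in (L + <[x]>)%VS -> z - phi z *: x \in L.
  case/memv_addP => l lL [_ /vlineP[c ->] ->].
  have -> : phi (l + c *: x) = c.
    by rewrite linearD linearZ /= phiL // phix add0r mulr1.
  by rewrite addrK.
(* The vertices lie in the translate of [L] where [phi] is [mu]; dividing them by [mu] brings them
   to [x + L]. *)
pose mu : R := phi (w ord0).
have wmu i : phi (w i) = mu.
  by apply/eqP; rewrite -subr_eq0 -linearB phiL.
have mu0 : mu != 0.
  apply/negP => /eqP mu0; have [wN /negP] := wNL ord0; apply.
  by have := memN _ wN; rewrite -/mu mu0 scale0r subr0.
have [v vE] : exists v, forall i, v i = mu^-1 *: w i.
  by exists (fun i => mu^-1 *: w i).
have wE i : w i = mu *: v i by rewrite vE scalerA mulfV ?scale1r.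
have phiv i : phi (v i) = 1.
  by rewrite vE linearZ /= wmu mulVf.
have vx i : v i - x \in L.
  have := memvZ mu^-1 (memN _ (proj1 (wNL i))).
  by rewrite scalerBr wmu scalerA mulVf // scale1r -vE.
have vL i j : v i - v j \in L by rewrite !vE -scalerBr memvZ.
have hull a : \sum_i a i = 1 :> R -> phi (\sum_i a i *: v i) = 1.
  move=> a1'; rewrite linear_sum -[RHS]a1'; apply: eq_bigr => i _.
  by rewrite linearZ /= phiv mulr1.
have sumw (a : 'I_8 -> R) : \sum_i a i *: w i = mu *: \sum_i a i *: v i.
  by rewrite scaler_sumr; apply: eq_bigr => i _; rewrite wE !scalerA mulrC.
have phi_neq0 y : phi y != 0 -> y != 0.
  by apply: contra => /eqP ->; rewrite linear0.
have secE y : affine_section L D x y <-> exists a : 'I_8 -> R,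
      [/\ forall i, 0 <= a i, \sum_i a i = 1 & y = \sum_i a i *: v i].
  split=> [[yx Dy]|[a [a0 sa yE]]].
    have phiy : phi y = 1.
      by have := phiL _ yx; rewrite linearB /= phix => /subr0_eq.
    have : section D (L + <[x]>)%VS <[y]>%VS.
      split=> //=; rewrite -memvE -(subrK x y) memv_add ?memv_line //.
    rewrite DE => -[a [a0 sa e]]; exists a; split=> //.
    have [|c c0 yc] := vline_eq _ e; first by rewrite phi_neq0 ?phiy ?oner_eq0.
    have : phi y = 1 by []; rewrite {1}yc sumw !linearZ /= hull // mulr1 => cmu.
    by rewrite yc sumw scalerA cmu scale1r.
  split.
    have -> : y - x = \sum_i a i *: (v i - x).
      under eq_bigr do rewrite scalerBr.
      by rewrite sumrB -scaler_suml sa scale1r -yE.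
    by apply: memv_suml => i _; rewrite memvZ.
  have : section D (L + <[x]>)%VS <[\sum_i a i *: w i]>%VS.
    by rewrite DE; exists a.
  by rewrite sumw vlineZ // -yE => -[].
split; [by exists v | move=> y yx ybd; apply/secE].
pose X z : R * R := (al z, be z).
(* A generator of [p j] lies in [L], where [phi] vanishes, so its coefficients on the two vertices
   are opposite and the side is parallel to it. *)
have sideE i : exists j, exists2 k : R, k != 0 &
    al (v (ordS i)) - al (v i) = - k * t j /\ be (v (ordS i)) - be (v i) = k.
  have [j] := wside i; rewrite pE -memvE => /memv_addP[_ /vlineP[a ->]].
  move=> [_ /vlineP[b ->] qE]; exists j.
  have qL : e2 - t j *: e1 \in L by rewrite rpredB ?memvZ.
  have ab : a = - b.
    have := phiL _ qL; rewrite qE linearD !linearZ /= !wmu -mulrDl => /eqP.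
    by rewrite mulf_eq0 (negbTE mu0) orbF addr_eq0 => /eqP.
  have qv : e2 - t j *: e1 = (b * mu) *: (v (ordS i) - v i).
    by rewrite qE ab !wE scalerBr !scalerA mulNr scaleNr addrC.
  have qa : al (e2 - t j *: e1) = - t j.
    by rewrite linearB linearZ /= a1 a2 mulr1 sub0r.
  have qb : be (e2 - t j *: e1) = 1.
    by rewrite linearB linearZ /= b1 b2 mulr0 subr0.
  have ga : - t j = b * mu * (al (v (ordS i)) - al (v i)).
    by rewrite -qa qv linearZ linearB.
  have gb : 1 = b * mu * (be (v (ordS i)) - be (v i)).
    by rewrite -qb qv linearZ linearB.
  have bm0 : b * mu != 0.
    by apply/eqP => e; move: gb; rewrite e mul0r => /eqP; rewrite oner_eq0.
  exists (b * mu)^-1; first by rewrite invr_eq0.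
  split; apply: (mulfI bm0).
    by rewrite -ga mulNr mulrN mulrA mulfV ?mul1r.
  by rewrite -gb mulfV.
have orientE i : exists j, exists2 k : R, k != 0 & forall z,
    orient (X (v i)) (X (v (ordS i))) (X z) =
    k * ((al z + t j * be z) - (al (v i) + t j * be (v i))).
  have [j [k k0 [ea eb]]] := sideE i.
  exists j; exists (- k); rewrite ?oppr_eq0 // => z.
  by rewrite /orient /X /= ea eb; ring.
(* Otherwise the segment between the vertices [j] and [l] would meet the line of side [i], which
   [wconv] excludes. *)
have conv (i j l : 'I_8) : j \notin [:: i; ordS i] -> l \notin [:: i; ordS i] ->
     0 < orient (X (v i)) (X (v (ordS i))) (X (v j)) *
         orient (X (v i)) (X (v (ordS i))) (X (v l)).
  move=> jni lni; set o := orient (X (v i)) (X (v (ordS i))).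
  rewrite ltNge; apply/negP => ojl.
  have [s s01 s0] : exists2 s : R, 0 <= s <= 1 &
      (1 - s) * o (X (v j)) + s * o (X (v l)) = 0.
    exact: zero_on_segment.
  have /negP := wconv i j l jni lni s s01; apply.
  have [dir [kk k0 [ea eb]]] := sideE i.
  pose z := (1 - s) *: v j + s *: v l.
  have comb (f : {scalar 'rV[R]_n.+1}) (p' q : R) y1 y2 :
      f (p' *: y1 + q *: y2) = p' * f y1 + q * f y2.
    by rewrite linearD !linearZ.
  have zxi : al z + t dir * be z = al (v i) + t dir * be (v i).
    apply/eqP; rewrite -subr_eq0; apply/eqP; apply: (mulfI k0).
    rewrite mulr0 -[RHS]oppr0 -s0 /o /orient /X /= ea eb /z !comb; ring.
  pose r := (be z - be (v i)) / kk.
  have zE : z = (1 - r) *: v i + r *: v (ordS i).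
    apply: (frame_inj fr).
    - have -> : z - ((1 - r) *: v i + r *: v (ordS i)) =
        (v j - v i) + s *: (v l - v j) - r *: (v (ordS i) - v i).
        by apply/rowP => q; rewrite /z !mxE; ring.
      apply: rpredB; first apply: rpredD; by rewrite ?memvZ ?vL.
    - rewrite [RHS]comb (_ : al (v (ordS i)) = al (v i) - kk * t dir); last lra.
      have -> : al z = al (v i) + t dir * (be (v i) - be z) by lra.
      by rewrite /r; field.
    - rewrite [RHS]comb (_ : be (v (ordS i)) = be (v i) + kk); last by lra.
      by rewrite /r; field.
  have -> : (1 - s) *: w j + s *: w l = (1 - r) *: w i + r *: w (ordS i).
    transitivity (mu *: z); last rewrite zE;
      by apply/rowP => q; rewrite !wE /z !mxE; ring.
  by rewrite /side_line memv_add ?memvZ ?memv_line.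
have [||a [a0 sa aX aY]] := @polygon_of_halfplanes _ 5 (X \o v) (X y).
- exact: conv.
- move=> i j; have [dir [kk k0 oE]] := orientE i.
  have [z1 [z2 [/secE[c1 [c10 c1s ->]] /secE[c2 [c20 c2s ->]] h1 h2]]] :=
    ybd dir.
  have same l : 0 <= orient (X (v i)) (X (v (ordS i))) (X (v j)) *
                     orient (X (v i)) (X (v (ordS i))) (X (v l)).
    have on_side m : m \in [:: i; ordS i] ->
        orient (X (v i)) (X (v (ordS i))) (X (v m)) = 0.
      by rewrite !inE => /orP[/eqP->|/eqP->]; rewrite /orient; ring.
    have [/on_side ->|ji] := boolP (j \in [:: i; ordS i]).
      by rewrite mul0r.
    have [/on_side ->|li] := boolP (l \in [:: i; ordS i]).
      by rewrite mulr0.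
    exact/ltW/conv.
  have k2 : 0 < kk ^+ 2 by rewrite exprn_even_gt0.
  have kkM (p1 q : R) : kk * p1 * (kk * q) = kk ^+ 2 * (p1 * q) by ring.
  move: h1 h2; rewrite !oE kkM (pmulr_rge0 _ k2).
  set C := al (v i) + _; set J := al (v j) + _ => h1 h2.
  (* The whole hull is on the same side of the level [C] as the vertex [j]; applied to [z1] and
     [z2], this traps [y] between them. *)
  have hull_side c : (forall l, 0 <= c l) -> \sum_l c l = 1 -> 0 <= (J - C) *
      (al (\sum_l c l *: v l) + t dir * be (\sum_l c l *: v l) - C).
    move=> c0 cs; rewrite !linear_sum mulr_sumr -big_split -{2}[C]mul1r -cs.
    rewrite mulr_suml -sumrB mulr_sumr; apply: sumr_ge0 => l _.
    have := same l; rewrite !oE kkM (pmulr_rge0 _ k2) -/C -/J.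
    move=> /(mulr_ge0 (c0 l)).
    have lZ (f : {scalar 'rV[R]_n.+1}) d u : f (d *: u) = d * f u.
      by rewrite linearZ.
    by rewrite !lZ /=; congr (_ <= _); ring.
  apply: between_ge0 (hull_side _ c20 c2s) (hull_side _ c10 c1s).
    by rewrite lerD2r.
  by rewrite lerD2r.
exists a; split=> //; apply: (frame_inj fr).
- have -> : y - \sum_i a i *: v i = (y - x) - \sum_i a i *: (v i - x).
    under [in RHS]eq_bigr do rewrite scalerBr.
    by rewrite sumrB -scaler_suml sa scale1r opprB addrA subrK.
  by rewrite rpredB // memv_suml // => i _; rewrite memvZ.
- by rewrite -[LHS]aX linear_sum; apply: eq_bigr => i _; rewrite linearZ.
- by rewrite -[LHS]aY linear_sum; apply: eq_bigr => i _; rewrite linearZ.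
Qed.

(** * Convex combinations, translates and multiples *)

Lemma convex_set_comb (R : realType) (M : lmodType R) (A : set M) (x y : M)
    (a b : R) : convex_set (A : set (convex_lmodType M)) -> A x -> A y ->
  0 <= a -> 0 <= b -> a + b = 1 -> A (a *: x + b *: y).
Proof.
move=> cA Ax Ay a0 b0 ab.
have a1 : a <= 1 by lra.
have := cA x y (Itv01 a0 a1); rewrite !in_setE => /(_ Ax Ay).
by rewrite (_ : b = 1 - a) //; lra.
Qed.

Lemma affine_section_shift (R : realType) (n : nat) (L : psubspace R n) D x l :
  l \in L -> affine_section L D (x + l) = affine_section L D x.
Proof.
move=> lL; apply/seteqP; split=> y [yx Dy]; split=> //.
  by have := rpredD yx lL; rewrite opprD addrA subrK.
by have := rpredB yx lL; rewrite opprD addrA.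
Qed.

Lemma affine_sectionZ (R : realType) (n : nat) (L : psubspace R n) D x c y :
  c != 0 -> affine_section L D x y -> affine_section L D (c *: x) (c *: y).
Proof. by move=> c0 [yx Dy]; split; rewrite ?vlineZ // -scalerBr memvZ. Qed.

Lemma affine_section_center (R : realType) (n : nat) (L : psubspace R n) D x :
  section D L = set0 -> x \in L -> affine_section L D x = set0.
Proof.
move=> DL xL; apply/seteqP; split=> // y [yx Dy].
have yL : y \in L by rewrite -(subrK x y) rpredD.
by have : section D L <[y]>%VS by []; rewrite DL.
Qed.

(** * Support functions *)

(* This is 0 on L, where the affine section is empty and sup set0 = 0. *)
Definition support_fun (R : realType) (n : nat) (L : psubspace R n)
    (D : set (psubspace R n)) (f : 'rV[R]_n.+1 -> R) (x : 'rV[R]_n.+1) : R :=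
  sup [set f y | y in affine_section L D x].

Lemma sup_max (R : realType) (E : set R) m : E m -> ubound E m -> sup E = m.
Proof.
move=> Em uE; apply/le_anti/andP; split; first by apply: ge_sup => //; exists m.
by apply: ub_le_sup => //; exists m.
Qed.

Lemma hull_max (R : realType) (V : lmodType R) k (v : 'I_k.+1 -> V)
    (f : {scalar V}) : exists i,
  forall a : 'I_k.+1 -> R, (forall i, 0 <= a i) -> \sum_i a i = 1 ->
    f (\sum_i a i *: v i) <= f (v i).
Proof.
exists [arg max_(i > ord0) f (v i)]%O; case: arg_maxP => // i _ im a a0 a1.
rewrite linear_sum -[f (v i)]mul1r -a1 mulr_suml; apply: ler_sum => j _.
by rewrite linearZ /= ler_wpM2l //; apply: im.
Qed.

Lemma support_attained (R : realType) (n : nat) (L : psubspace R n)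
    (D : set (psubspace R n)) (f : {scalar 'rV[R]_n.+1}) x :
  polygonal L D x ->
  exists y, [/\ affine_section L D x y, f y = support_fun L D f x &
    forall z, affine_section L D x z -> f z <= f y].
Proof.
move=> [v Sv]; have [i im] := hull_max v f.
have vi : affine_section L D x (v i).
  apply/Sv; exists (fun j => (j == i)%:R); split=> [j||].
  - by rewrite ler0n.
  - by rewrite (bigD1 i) //= eqxx big1 ?addr0 // => j /negbTE ->.
  - rewrite (bigD1 i) //= eqxx scale1r big1 ?addr0 // => j /negbTE ->.
    by rewrite scale0r.
have vm z : affine_section L D x z -> f z <= f (v i).
  by move=> /Sv [a [a0 a1 ->]]; apply: im.
exists (v i); split=> //; apply/esym/sup_max; first by exists (v i).
by move=> _ [z Sz <-]; apply: vm.
Qed.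

Lemma le_support (R : realType) (n : nat) (L : psubspace R n)
    (D : set (psubspace R n)) (f : {scalar 'rV[R]_n.+1}) x y :
  polygonal L D x -> affine_section L D x y -> f y <= support_fun L D f x.
Proof. by move=> /(support_attained f)[z [_ <- zm]]; apply: zm. Qed.

Lemma affine_section_convex (R : realType) (n : nat) (L : psubspace R n)
    (D : set (psubspace R n)) x y z a b :
  polygonal L D x -> affine_section L D x y -> affine_section L D x z ->
  0 <= a -> 0 <= b -> a + b = 1 -> affine_section L D x (a *: y + b *: z).
Proof.
move=> [v Sv] /Sv [c [c0 c1 ->]] /Sv [d [d0 d1 ->]] a0 b0 ab; apply/Sv.
exists (fun i => a * c i + b * d i); split=> [i||].
- by rewrite addr_ge0 ?mulr_ge0.
- by rewrite big_split -!mulr_sumr /= c1 d1 !mulr1.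
- rewrite !scaler_sumr -big_split; apply: eq_bigr => i _ /=.
  by rewrite scalerDl !scalerA.
Qed.

Lemma support_center (R : realType) (n : nat) (L : psubspace R n)
    (D : set (psubspace R n)) (f : {scalar 'rV[R]_n.+1}) x :
  section D L = set0 -> x \in L -> support_fun L D f x = 0.
Proof.
by move=> DL xL; rewrite /support_fun affine_section_center // image_set0 sup0.
Qed.

Lemma support_shift (R : realType) (n : nat) (L : psubspace R n)
    (D : set (psubspace R n)) (f : {scalar 'rV[R]_n.+1}) x l :
  l \in L -> support_fun L D f (x + l) = support_fun L D f x.
Proof. by move=> lL; rewrite /support_fun affine_section_shift. Qed.

Lemma polygonalZ (R : realType) (n : nat) (L : psubspace R n)
    (D : set (psubspace R n)) x c :
  c != 0 -> polygonal L D x -> polygonal L D (c *: x).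
Proof.
move=> c0 [v Sv]; exists (fun i => c *: v i) => y; split.
  move=> Sy; have : affine_section L D x (c^-1 *: y).
    by have := affine_sectionZ (invr_neq0 c0) Sy; rewrite scalerK.
  case/Sv => a [a0 a1 yE]; exists a; split=> //.
  rewrite -[LHS]scale1r -(mulfV c0) -scalerA yE scaler_sumr.
  by apply: eq_bigr => i _; rewrite !scalerA mulrC.
case=> a [a0 a1 ->].
have -> : \sum_i a i *: (c *: v i) = c *: \sum_i a i *: v i.
  by rewrite scaler_sumr; apply: eq_bigr => i _; rewrite !scalerA mulrC.
by apply: affine_sectionZ => //; apply/Sv; exists a.
Qed.

Lemma supportZ (R : realType) (n : nat) (L : psubspace R n)
    (D : set (psubspace R n)) :
  section D L = set0 -> (forall x, x \notin L -> polygonal L D x) ->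
  forall (f : {scalar 'rV[R]_n.+1}) x c, 0 < c ->
  support_fun L D f (c *: x) = c * support_fun L D f x.
Proof.
move=> DL poly f x c c0; have cn0 : c != 0 by rewrite gt_eqF.
have [xL|xL] := boolP (x \in L); first by rewrite !support_center ?memvZ ?mulr0.
have [y [Sy <- ym]] := support_attained f (poly _ xL).
apply: sup_max.
  by exists (c *: y); rewrite ?linearZ //; apply: affine_sectionZ.
move=> _ [z Sz <-]; have Sz' : affine_section L D x (c^-1 *: z).
  by have := affine_sectionZ (invr_neq0 cn0) Sz; rewrite scalerK.
by rewrite -(scalerKV cn0 z) linearZ ler_pM2l // ym.
Qed.

(** The section over [- x] is the reflection of the one over [x], so the support function at [- x]
    controls the minimum of [f]. *)
Lemma le_supportN (R : realType) (n : nat) (L : psubspace R n)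
    (D : set (psubspace R n)) (f : {scalar 'rV[R]_n.+1}) x y :
  (forall x, x \notin L -> polygonal L D x) ->
  affine_section L D x y -> x \notin L ->
  f (- y) <= support_fun L D f (- x).
Proof.
move=> poly Sy xL; apply: le_support; rewrite -(scaleN1r x) -?(scaleN1r y).
  by apply: polygonalZ; rewrite ?oppr_eq0 ?oner_eq0 //; apply: poly.
by apply: affine_sectionZ => //; rewrite oppr_eq0 oner_eq0.
Qed.

(** At a point where [f] is maximal on the section, [g] and [h] are at most their own maxima. *)
Lemma support_comb (R : realType) (n : nat) (L : psubspace R n)
    (D : set (psubspace R n)) :
  section D L = set0 -> (forall x, x \notin L -> polygonal L D x) ->
  forall (f g h : {scalar 'rV[R]_n.+1}) (a b c : R) x,
  0 < a -> 0 < b -> 0 < c ->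
  (forall y, c * f y = a * g y + b * h y) ->
  c * support_fun L D f x <= a * support_fun L D g x + b * support_fun L D h x.
Proof.
move=> DL poly f g h a b c x a0 b0 c0 fE.
have [xL|xL] := boolP (x \in L).
  by rewrite !support_center // !mulr0 addr0.
have [y [Sy <- _]] := support_attained f (poly _ xL); rewrite fE.
by apply: lerD; rewrite ler_pM2l // le_support //; apply: poly.
Qed.

Lemma support_combN (R : realType) (n : nat) (L : psubspace R n)
    (D : set (psubspace R n)) :
  section D L = set0 -> (forall x, x \notin L -> polygonal L D x) ->
  forall (f g h : {scalar 'rV[R]_n.+1}) (a b c : R) x,
  0 < a -> 0 < b -> 0 < c ->
  (forall y, c * f y = a * g (- y) + b * h y) ->
  c * support_fun L D f x <=
    a * support_fun L D g (- x) + b * support_fun L D h x.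
Proof.
move=> DL poly f g h a b c x a0 b0 c0 fE; have [xL|xL] := boolP (x \in L).
  by rewrite !support_center ?rpredN // !mulr0 addr0.
have [y [Sy <- _]] := support_attained f (poly _ xL); rewrite fE.
apply: lerD; rewrite ler_pM2l //; first exact: le_supportN.
by rewrite le_support //; apply: poly.
Qed.

(** * Projections from points of [L] and sublinearity *)

Lemma dimv_addl1 (K : fieldType) (V : vectType K) (U : {vspace V}) v :
  v \notin U -> \dim (U + <[v]>) = (\dim U).+1.
Proof.
move=> vU; have v0 : v != 0 by apply: contra vU => /eqP ->; rewrite mem0v.
rewrite dimv_disjoint_sum ?dim_vline ?v0 ?addn1 //.
apply/eqP; rewrite -subv0; apply/subvP => w /memv_capP[wU /vlineP[c wE]].
move: wU; rewrite wE; have [->|c0] := eqVneq c 0.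
  by rewrite scale0r !mem0v.
by move=> /(memvZ c^-1); rewrite scalerK // (negbTE vU).
Qed.

(** A representative in [T + <[x]>] of a point of [D] has a nonzero coefficient on [x], because [D]
    misses [L]; dividing by it gives a representative in [x + T]. *)
Lemma projection_mem (R : realType) (n : nat) (L T : psubspace R n)
    (D : set (psubspace R n)) x :
  D `<=` @RP R n -> section D L = set0 -> (T <= L)%VS -> x \notin T ->
  projection T D (T + <[x]>)%VS <->
  exists2 y, affine_section L D x y & y - x \in T.
Proof.
move=> DRP DL TL xT; split=> [[U DU]|[y [yx Dy] yxT]].
  have [_ _ dU] := DRP _ DU.
  have UE : U = <[vpick U]>%VS.
    apply/esym/eqP; rewrite eqEdim -memvE memv_pick dim_vline vpick0.
    by rewrite -dimv_eq0 dU dimv0.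
  set u := vpick U in UE; rewrite UE in DU * => e.
  have : u \in (T + <[x]>)%VS by rewrite -e (subvP (addvSr _ _)) ?memv_line.
  case/memv_addP => w wT [_ /vlineP[c ->] uE].
  have c0 : c != 0.
    apply/eqP => c0; have : section D L <[u]>%VS.
      by split=> //=; rewrite -memvE uE c0 scale0r addr0 (subvP TL).
    by rewrite DL.
  have yE : c^-1 *: u - x = c^-1 *: w.
    by rewrite uE scalerDr scalerK // addrK.
  have yT : c^-1 *: u - x \in T by rewrite yE memvZ.
  exists (c^-1 *: u) => //; split; first exact: (subvP TL).
  by rewrite vlineZ ?invr_eq0.
exists <[y]>%VS => //; have y_eq : y = (y - x) + x by rewrite subrK.
apply/eqP; rewrite eqEsubv !subv_add !addvSl /= -!memvE.
rewrite {1}y_eq memv_add ?memv_line //=.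
have -> : x = - (y - x) + y by rewrite opprB subrK.
by rewrite memv_add ?memv_line ?rpredN.
Qed.

(* The hyperplane H avoiding the complement A of the projection is the kernel of
   a form phi equal to xi on L, and g = xi - phi satisfies g <= support_fun. In
   the affine chart phi = 1, A is {support_fun - g < 1}, so support_fun - g is
   the gauge of a convex set. *)
Lemma support_sublinear (R : realType) (n : nat) (L T : psubspace R n)
    (D : set (psubspace R n)) (xi : {scalar 'rV[R]_n.+1}) (e : 'rV[R]_n.+1) :
  D `<=` @RP R n -> section D L = set0 ->
  (forall x, x \notin L -> polygonal L D x) ->
  (T <= L)%VS -> (\dim T).+1 = \dim L -> e \in L -> xi e = 1 ->
  (forall l, l \in L -> (l \in T) = (xi l == 0)) ->
  pconvex T fullv (ppoints T fullv `\` projection T D) ->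
  sublinear (support_fun L D xi).
Proof.
move=> DRP DL poly TL dT eL xie Tker [_ _ [H [/andP[TH _] dH AH cH]]].
set A := _ `\` _ in AH cH.
have xZ x (c : R) : xi (c *: x) = c * xi x by rewrite linearZ.
have xD x y : xi (x + y) = xi x + xi y by rewrite linearD.
have LT l : l \in L -> l - xi l *: e \in T.
  by move=> lL; rewrite Tker ?rpredB ?memvZ // linearB xZ xie mulr1 subrr.
have AL : A L.
  split; first by split; rewrite ?subvf.
  move=> [U DU TU]; have : section D L U by split=> //=; rewrite -TU addvSr.
  by rewrite DL.
(* [L] itself is a point of the complement [A], and [H] would contain it if it contained [e]. *)
have eH : e \notin H.
  apply: contra (AH _ AL) => eH; apply/subvP => l lL.
  by rewrite -(subrK (xi l *: e) l) rpredD ?memvZ // (subvP TH) ?LT.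
have [phi [phiH phie]] := separating_form eH.
have pZ x (c : R) : phi (c *: x) = c * phi x by rewrite linearZ.
have pD x y : phi (x + y) = phi x + phi y by rewrite linearD.
have Hfull : (H + <[e]>)%VS = fullv.
  by apply/eqP; rewrite eqEdim subvf -dH dimv_addl1 //=.
have phi0 x : phi x = 0 -> x \in H.
  have : x \in (H + <[e]>)%VS by rewrite Hfull memvf.
  case/memv_addP => h hH [_ /vlineP[c ->] ->].
  by rewrite pD pZ phiH // phie add0r mulr1 => ->; rewrite scale0r addr0.
have phiL l : l \in L -> phi l = xi l.
  move=> lL; rewrite -{1}(subrK (xi l *: e) l) pD pZ phie mulr1 phiH ?add0r //.
  by rewrite (subvP TH) ?LT.
have notT x : x \notin L -> x \notin T by apply: contra; apply: subvP.
have Apt x : x \notin T -> A (T + <[x]>)%VS <->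
    ~ exists2 y, affine_section L D x y & y - x \in T.
  move=> xT; rewrite -(projection_mem DRP DL TL xT); split=> [[]//|nP].
  by split=> //; split; rewrite ?addvSl ?subvf // dimv_addl1.
(* Sliding [x] along [e] into [H] gives a point outside [A], hence a point of the projection of
   [D]. *)
have graph x : x \notin L ->
    exists2 y, affine_section L D x y & xi y = xi x - phi x.
  move=> xL; pose x' := x + (- phi x) *: e.
  have x'L : x' \notin L.
    by apply: contra xL => h; rewrite -(addrK ((- phi x) *: e) x) rpredB ?memvZ.
  have x'H : x' \in H by apply: phi0; rewrite pD pZ phie mulr1 subrr.
  have [y Sy yT] : exists2 y, affine_section L D x' y & y - x' \in T.
    apply: contrapT => /(Apt _ (notT _ x'L)) /AH /negP; apply.
    by rewrite subv_add TH -memvE.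
  exists y; first by move: Sy; rewrite affine_section_shift ?memvZ.
  have : xi (y - x') = 0.
    by apply/eqP; rewrite -Tker // (subvP TL).
  by rewrite linearB xD xZ xie mulr1 => /subr0_eq.
pose k x := support_fun L D xi x - (xi x - phi x).
have k0 x : 0 <= k x.
  rewrite subr_ge0; have [xL|xL] := boolP (x \in L).
    by rewrite support_center // phiL // subrr.
  by have [y Sy <-] := graph x xL; apply: le_support => //; apply: poly.
have Omega x : phi x = 1 -> A (T + <[x]>)%VS <-> k x < 1.
  move=> phix.
  have xT : x \notin T.
    by apply/negP => /(subvP TH)/phiH; rewrite phix => /eqP; rewrite oner_eq0.
  rewrite Apt // /k phix; have [xL|xL] := boolP (x \in L).
    rewrite support_center // -(phiL x xL) phix subrr subr0; split=> // _.
    by move=> [y]; rewrite affine_section_center.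
  have Px := poly _ xL; split=> [nS|lt [y Sy yT]]; last first.
    have : xi (y - x) = 0 by apply/eqP; rewrite -Tker // (subvP TL).
    rewrite linearB => /subr0_eq xyE.
    by have := le_support xi Px Sy; rewrite xyE; lra.
  (* On the section [xi] takes the value [xi x - 1] and a value at least [xi x]; on the segment
     between, the point of weight [d^-1] has the value [xi x]. *)
  rewrite ltNge; apply/negP => ge; apply: nS.
  have [y1 Sy1 y1E] := graph x xL; rewrite phix in y1E.
  have [y2 [Sy2 y2E _]] := support_attained xi Px.
  pose d := xi y2 - xi y1; have d1 : 1 <= d by rewrite /d; lra.
  have dn0 : d != 0 by rewrite gt_eqF //; lra.
  have i0 : 0 <= d^-1 by rewrite invr_ge0; lra.
  have i1 : d^-1 <= 1 by rewrite invf_le1 //; lra.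
  have Sy := affine_section_convex Px Sy1 Sy2
    (_ : 0 <= 1 - d^-1) i0 (subrK _ _).
  eexists; first by apply: Sy; lra.
  have {}Sy := Sy ltac:(lra); case: Sy => yL _.
  rewrite Tker // linearB xD !xZ subr_eq0; apply/eqP.
  transitivity (xi y1 + d^-1 * d); first by rewrite /d; ring.
  by rewrite mulVf // y1E subrK.
have suppZ := supportZ DL poly.
have kZ c x : 0 < c -> k (c *: x) = c * k x.
  by move=> c0; rewrite /k suppZ // xZ pZ; ring.
have kshift x l : l \in L -> k (x + l) = k x.
  by move=> lL; rewrite /k support_shift // xD pD (phiL l lL); ring.
split=> [c x c0|x y]; first exact: suppZ.
suff: k (x + y) <= k x + k y by rewrite /k xD pD; lra.
(* [k] may vanish, so the scaling factors [s] and [r] are taken slightly above [k x] and [k y]. *)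
apply/ler_addgt0Pr => eps eps0.
pose s := k x + eps / 2; pose r := k y + eps / 2.
have s0 : 0 < s by have := k0 x; rewrite /s; lra.
have r0 : 0 < r by have := k0 y; rewrite /r; lra.
have norm z (c : R) : 0 < c -> k z < c ->
    let z1 := c^-1 *: z + (1 - c^-1 * phi z) *: e in
    z1 - e \in H /\ A (T + <[z1]>)%VS.
  move=> c0 kz z1; have z11 : phi z1 = 1 by rewrite pD !pZ phie; ring.
  split; first by apply: phi0; rewrite linearB z11 phie subrr.
  apply/Omega => //; rewrite kshift ?memvZ // kZ ?invr_gt0 //.
  by rewrite mulrC ltr_pdivrMr ?mul1r.
have xN := norm x s s0 ltac:(rewrite /s; lra).
have yN := norm y r r0 ltac:(rewrite /r; lra).
have sr0 : 0 < s + r by lra.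
(* With these weights the combination is [x + y] divided by [s + r], up to a multiple of [e], which
   leaves [k] unchanged. *)
have := convex_set_comb (cH e (memvf _) eH) xN yN
  (_ : 0 <= s / (s + r)) (_ : 0 <= r / (s + r)) (_ : _ = 1).
rewrite -mulrDl mulfV ?gt_eqF //.
move=> /(_ (ltW (divr_gt0 s0 sr0)) (ltW (divr_gt0 r0 sr0)) erefl).
set w := _ + _ => -[/phiH]; rewrite linearB phie => /subr0_eq w1 /(Omega _ w1).
pose c := s / (s + r) * (1 - s^-1 * phi x) + r / (s + r) * (1 - r^-1 * phi y).
have -> : w = (s + r)^-1 *: (x + y) + c *: e.
  apply/rowP => q; rewrite /w /c !mxE; field; rewrite !gt_eqF //.
rewrite kshift ?memvZ // kZ ?invr_gt0 // mulrC ltr_pdivrMr // mul1r /s /r; lra.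
Qed.

(** * The common transversal *)

Lemma vline_dim1 (K : fieldType) (V : vectType K) (U : {vspace V}) u :
  \dim U = 1%N -> u \in U -> u != 0 -> U = <[u]>%VS.
Proof.
by move=> dU uU u0; apply/esym/eqP; rewrite eqEdim -memvE uU dim_vline u0 dU.
Qed.

(** [e1] is chosen outside all four [p j], so that every direction has a finite slope [t j]. *)
Lemma frame_exists (R : realType) (n : nat) (L : psubspace R n)
    (p : 'I_4 -> psubspace R n) :
  \dim L = 2%N -> injective p -> (forall j, ppoints 0%VS L (p j)) ->
  exists (al be : {scalar 'rV[R]_n.+1}) e1 e2 (t : 'I_4 -> R),
    [/\ frame L al be e1 e2, injective t &
        forall j, p j = <[e2 - t j *: e1]>%VS].
Proof.
move=> dL pI pL.
have pjL j : (p j <= L)%VS by case: (pL j).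
have dp j : \dim (p j) = 1%N by case: (pL j) => _ _ ->; rewrite dimv0.
have pick0 j : vpick (p j) != 0 by rewrite vpick0 -dimv_eq0 dp.
pose r0 := vpick (p ord0); pose r1 := vpick (p (lift ord0 ord0)).
have pE j u : u \in p j -> u != 0 -> p j = <[u]>%VS by apply: vline_dim1.
have r01 j : r0 \in p j -> r1 \in p j -> False.
  move=> /pE/(_ (pick0 _)) e0 /pE/(_ (pick0 _)) e1.
  have E0 := pE _ _ (memv_pick _) (pick0 ord0).
  have E1 := pE _ _ (memv_pick _) (pick0 (lift ord0 ord0)).
  by have := pI _ _ (etrans E0 (etrans (esym e0) (etrans e1 (esym E1)))).
(* Pigeonhole on the five vectors [r0 + s r1]: two of them in one [p j] would put both [r0] and [r1]
   there. *)
have [e1 e1L e1p] : exists2 e1, e1 \in L & forall j, e1 \notin p j.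
  pose w (s : 'I_5) := r0 + (s%:R : R) *: r1.
  have wL s : w s \in L.
    by rewrite rpredD ?memvZ // (subvP (pjL _) _ (memv_pick _)).
  apply: contrapT => no.
  have bad s : exists j, w s \in p j.
    apply: contrapT => nj; apply: no; exists (w s) => // j.
    by apply/negP => wj; apply: nj; exists j.
  have [f fw] := fin_all_exists bad.
  have : ~~ injectiveb f.
    apply/negP => /injectiveP/card_codom fc.
    by have := max_card [in codom f]; rewrite fc !card_ord.
  case/injectivePn => s [s' ss' ff].
  have h : w s - w s' \in p (f s) by rewrite rpredB // ff.
  have wE : w s - w s' = (s%:R - s'%:R) *: r1.
    by rewrite /w opprD addrACA subrr add0r scalerBl.
  have n0 : (s%:R - s'%:R : R) != 0 by rewrite subr_eq0 eqr_nat.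
  have r1p : r1 \in p (f s).
    by rewrite -(scalerK n0 r1) memvZ // -wE.
  apply: (r01 _ _ r1p); have -> : r0 = w s - (s%:R : R) *: r1 by rewrite addrK.
  by rewrite rpredB ?memvZ ?fw.
have e10 : e1 != 0 by apply: contra (e1p ord0) => /eqP ->; rewrite mem0v.
have [e2 e2L e2e1] : exists2 e2, e2 \in L & e2 \notin <[e1]>%VS.
  apply/subvPn; apply/negP => /dimvS; by rewrite dL dim_vline e10.
have e12 : e1 \notin <[e2]>%VS.
  apply: contra e2e1 => /vlineP[c e1E].
  have c0 : c != 0 by apply: contra e10 => /eqP c0; rewrite e1E c0 scale0r.
  by rewrite e1E vlineZ ?memv_line.
have [al [al2 al1]] := separating_form e12.
have [be [be1 be2]] := separating_form e2e1.
have frL l : l \in L -> l = al l *: e1 + be l *: e2.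
  have -> : L = (<[e1]> + <[e2]>)%VS.
    apply/esym/eqP; rewrite eqEdim subv_add -!memvE e1L e2L /=.
    by rewrite dimv_addl1 // dim_vline e10 dL.
  case/memv_addP => _ /vlineP[a ->] [_ /vlineP[b ->] ->].
  rewrite !linearD !linearZ /= al1 be2 (al2 _ (memv_line _)).
  by rewrite (be1 _ (memv_line _)) !mulr1 !mulr0 add0r addr0.
have be_pick j : be (vpick (p j)) != 0.
  apply/eqP => b0; move: (e1p j).
  have := frL _ (subvP (pjL j) _ (memv_pick _)); rewrite b0 scale0r addr0 => pe.
  have a0 : al (vpick (p j)) != 0.
    by apply: contra (pick0 j) => /eqP a0; rewrite pe a0 scale0r.
  by rewrite -(scalerK a0 e1) -pe memvZ ?memv_pick.
pose t j := - (al (vpick (p j)) / be (vpick (p j))).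
have ptE j : p j = <[e2 - t j *: e1]>%VS.
  rewrite (pE _ _ (memv_pick _) (pick0 j)).
  rewrite (frL _ (subvP (pjL j) _ (memv_pick _))) -[RHS](vlineZ _ (be_pick j)).
  congr <[_]>%VS; rewrite scalerBr scalerA /t mulrN scaleNr opprK addrC.
  by rewrite mulrC divfK.
exists al, be, e1, e2, t; split=> //; last first.
  by move=> i j tij; apply: pI; rewrite !ptE tij.
split=> //; split=> //; [by apply: be1; rewrite memv_line|].
by apply: al2; rewrite memv_line.
Qed.

(** Listing the indices by increasing [t], strictly since [t] is injective, reduces the sum to the
    ordered case. *)
Lemma sorted_sum_ge0 (R : realType) (m : nat) (t : 'I_4 -> R)
    (h : 'I_4 -> 'rV[R]_m -> R) : injective t -> (forall i, sublinear (h i)) ->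
  (forall i j k (w : 'rV[R]_m), t i < t j -> t j < t k ->
     (t k - t i) * h j w <= (t k - t j) * h i w + (t j - t i) * h k w) ->
  (forall i j k (w : 'rV[R]_m), t i < t j -> t j < t k ->
     (t k - t j) * h i w <= (t j - t i) * h k (- w) + (t k - t i) * h j w) ->
  forall u : 'I_4 -> 'rV[R]_m, \sum_i u i = 0 -> \sum_i t i *: u i = 0 ->
    0 <= \sum_i h i (u i).
Proof.
move=> tI sh mid out u.
pose s := sort (relpre t <=%O) (enum 'I_4).
have ps : perm_eq (index_enum 'I_4) s by rewrite perm_sym perm_sort enumT.
rewrite !(perm_big _ ps) /=.
have ss : sorted (relpre t <%O) s.
  suff: sorted <%O (map t s) by rewrite sorted_map.
  rewrite lt_sorted_uniq_le map_inj_uniq // sort_uniq enum_uniq sorted_map.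
  by apply: sort_sorted => i j; apply: le_total.
have : size s = 4%N by rewrite size_sort size_enum_ord.
case: s ss {ps} => [|i1 [|i2 [|i3 [|i4 [|//]]]]] //=.
move=> /and4P[t12 t23 t34 _] _.
rewrite !big_cons !big_nil !addr0 !addrA => su stu.
apply: (@four_sublinear_ge0 _ _ _ _ _ _ (t i1) (t i2) (t i3) (t i4)) => //.
  by move=> w; apply: out => //; apply: lt_trans t34.
by move=> w; apply: mid.
Qed.

Lemma direction_forms (R : realType) (n : nat)
    (al be : {scalar 'rV[R]_n.+1}) (t : 'I_4 -> R) :
  exists xi : 'I_4 -> {scalar 'rV[R]_n.+1},
    forall j y, xi j y = al y + t j * be y.
Proof.
apply: (@fin_all_exists _ (fun=> {scalar 'rV[R]_n.+1})
  (fun j (f : {scalar 'rV[R]_n.+1}) => forall y, f y = al y + t j * be y)) => j.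
by apply: form_of_scalar => a x y; rewrite !linearP /=; ring.
Qed.

Theorem proposition3 (R : realType) (n : nat) (L : psubspace R n)
    (D : set (psubspace R n)) (p : 'I_4 -> psubspace R n) :
  \dim L = 2%N ->
  L_convex_concave L D ->
  injective p ->
  (forall j, ppoints 0%VS L (p j)) ->
  (forall N : psubspace R n, (L <= N)%VS -> \dim N = 3%N ->
     octagon_with_directions L N p (section D N)) ->
  exists M : psubspace R n,
    \dim M = n.-1 /\
    forall N : psubspace R n, (L <= N)%VS -> \dim N = 3%N ->
      section D N `&` [set U | (U <= M)%VS] !=set0.
Proof.
move=> dL [[DRP _] DL _ conc] pI pL oct.
have [al [be [e1 [e2 [t [fr tI pE]]]]]] := frame_exists dL pI pL.
have [[e1L e2L] [al1 be1] [al2 be2] frE] := fr.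
have alq j : al (e2 - t j *: e1) = - t j.
  by rewrite linearB linearZ /= al1 al2 mulr1 sub0r.
have beq j : be (e2 - t j *: e1) = 1.
  by rewrite linearB linearZ /= be1 be2 mulr0 subr0.
have octx x : x \notin L -> _ := fun xL => octagon_affine fr pE xL
  (oct _ (addvSl _ _) (etrans (dimv_addl1 xL) (congr1 S dL))).
have poly x : x \notin L -> polygonal L D x by case/octx.
have [xi xiE] := direction_forms al be t.
pose h j := support_fun L D (xi j).
have sh j : sublinear (h j).
  have pjL : (p j <= L)%VS by case: (pL j).
  have dpj : (\dim (p j)).+1 = \dim L.
    by case: (pL j) => _ _ ->; rewrite dimv0 dL.
  apply: (support_sublinear DRP DL poly pjL dpj e1L).
  - by rewrite xiE al1 be1 mulr0 addr0.
  - move=> l lL; rewrite pE xiE; apply/idP/eqP => [/vlineP[c ->]|xl].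
      have lZ (a : {scalar 'rV[R]_n.+1}) v : a (c *: v) = c * a v.
        by rewrite linearZ.
      by rewrite !lZ alq beq; ring.
    apply/vlineP; exists (be l); rewrite {1}(frE l lL) scalerBr scalerA addrC.
    congr (_ + _); rewrite -scaleNr; congr (_ *: _); lra.
  - by case: (conc _ pjL dpj).
have hsum : forall u : 'I_4 -> 'rV[R]_n.+1, \sum_i u i = 0 ->
    \sum_i t i *: u i = 0 -> 0 <= \sum_i h i (u i).
  apply: (sorted_sum_ge0 tI sh) => i j k w ij jk; have ik := lt_trans ij jk.
    apply: (support_comb DL poly); rewrite ?subr_gt0 //.
    by move=> y; rewrite !xiE; ring.
  apply: (support_combN DL poly); rewrite ?subr_gt0 //.
  by move=> y; rewrite !xiE !linearN; ring.
have [f [g fgh]] := simultaneous_functionals sh hsum.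
(* The [h j] vanish on [L], so the bounds at [l] and [- l] give [f l + t j * g l = 0], for two
   distinct slopes. *)
have fgL l : l \in L -> f l = 0 /\ g l = 0.
  move=> lL; have z j : f l + t j * g l = 0.
    have := fgh j l; have := fgh j (- l); rewrite /h !support_center ?rpredN //.
    by rewrite !linearN => h1 h2; lra.
  have t01 : t ord0 - t ord_max != 0.
    by rewrite subr_eq0; apply/negP => /eqP/tI.
  have g0 : g l = 0.
    apply: (mulfI t01); have := z ord0; have := z ord_max; lra.
  by have := z ord0; rewrite g0; lra.
(* [m] is the projection to [L] minus the map F with coordinates [f], [g]. It is the identity on
   [L], so it has rank 2 and its kernel has the right dimension. *)
have [m mE] : exists m : 'Hom('rV[R]_n.+1, 'rV[R]_n.+1),
    forall x, m x = (al x - f x) *: e1 + (be x - g x) *: e2.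
  apply: lfun_of_linear => a x y.
  have lP (s : {scalar 'rV[R]_n.+1}) : s (a *: x + y) = a * s x + s y.
    by rewrite linearP.
  by rewrite !lP; apply/rowP => q; rewrite !mxE; ring.
have mL x : m x \in L by rewrite mE rpredD ?memvZ.
have mid l : l \in L -> m l = l.
  by move=> lL; have [f0 g0] := fgL l lL; rewrite mE f0 g0 !subr0 -frE.
exists (lker m); split.
  have := limg_ker_dim m fullv; rewrite capfv.
  have -> : (m @: fullv)%VS = L.
    apply/eqP; rewrite eqEsubv; apply/andP; split.
      by apply/subvP => _ /memv_imgP[x _ ->].
    by apply/subvP => l lL; rewrite -(mid l lL) memv_img ?memvf.
  by rewrite dL dimvf /dim /= mul1n addn2 => -[/(congr1 predn)].
move=> N LN dN.
have [x xN xL] : exists2 x, x \in N & x \notin L.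
  by apply/subvPn; apply/negP => /dimvS; rewrite dL dN.
pose y := x - m x.
have yx : y - x \in L by rewrite /y addrAC subrr add0r rpredN.
have yN : y \in N by rewrite rpredB // (subvP LN).
have aly : al y = f x.
  by rewrite linearB mE linearD !linearZ /= al1 al2 mulr1 mulr0 addr0 subKr.
have bey : be y = g x.
  by rewrite linearB mE linearD !linearZ /= be1 be2 mulr1 mulr0 add0r subKr.
(* In the frame, [y] has coordinates [f x] and [g x]; the bounds at [x] and [- x] place each
   [xi j y] between the extrema of [xi j] on the section, the minimum being attained at [- z2]. *)
have [_ Dy] : affine_section L D x y.
  apply: (octx x xL).2 => // j; rewrite aly bey.
  have [z1 [Sz1 z1E _]] := support_attained (xi j) (poly _ xL).
  have NxL : - x \notin L by rewrite rpredN.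
  have [z2 [Sz2 z2E _]] := support_attained (xi j) (poly _ NxL).
  exists z1, (- z2); split=> //.
  - have := @affine_sectionZ _ _ _ D _ (-1) z2 (_ : -1 != 0) Sz2.
    by rewrite !scaleN1r opprK; apply; rewrite oppr_eq0 oner_eq0.
  - by rewrite -xiE z1E; apply: fgh.
  - have := fgh j (- x); rewrite /h -z2E xiE !linearN; lra.
exists <[y]>%VS; split; [split=> //|] => /=; rewrite -memvE //.
by rewrite memv_ker /y linearB /= (mid (m x)) ?subrr.
Qed.
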